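(* For all $n\geq 1$ and $\sigma\in\{123,132,231\}$, the number of desarrangements of length $n$ avoiding both $213$ and $\sigma$ is $d_n(213,\sigma)=J_{n-1}$, the $(n-1)$st Jacobsthal number.
   Context: Permutations are in one-line notation. An index $i\in[n-1]$ is a descent of $\pi\in\mathfrak{S}_n$ if $\pi_i>\pi_{i+1}$; $i\in[n]$ is an ascent if it is not a descent (so $n$ is always an ascent). A desarrangement is a permutation whose first ascent is even. $d_n(\Pi)$ is the number of desarrangements in $\mathfrak{S}_n$ avoiding every pattern in $\Pi$ ($\pi$ avoids $\sigma$ if no subsequence of $\pi$ has the same relative order as $\sigma$). The Jacobsthal numbers are defined by $J_0=0$, $J_1=1$, $J_n=J_{n-1}+2J_{n-2}$ for $n\ge2$. *)

(* Defs.v *)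
From mathcomp Require Import all_boot all_fingroup.

Set Implicit Arguments.
Unset Strict Implicit.
Unset Printing Implicit Defensive.

(* One-line notation: 'S_n acts on {0, ..., n-1}, so values are shifted to
   {1, ..., n}. *)
Definition one_line (n : nat) (p : 'S_n) : seq nat :=
  [seq (p i).+1 | i <- enum 'I_n].

(* Positions are numbered from 1, so the entry w_i is [nth 0 w i.-1]. *)
Definition descent (w : seq nat) (i : nat) : bool :=
  (0 < i < size w) && (nth 0 w i.-1 > nth 0 w i).

Definition ascent (w : seq nat) (i : nat) : bool :=
  (0 < i <= size w) && ~~ descent w i.

(* The default 0 is reached only by the empty word: otherwise [size w] is an
   ascent. *)
Definition first_ascent (w : seq nat) : nat :=
  head 0 [seq i <- iota 1 (size w) | ascent w i].

Definition desarrangement (n : nat) (p : 'S_n) : bool :=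
  ~~ odd (first_ascent (one_line p)).

Definition same_order (u v : seq nat) : bool :=
  (size u == size v) &&
  [forall i : 'I_(size u), forall j : 'I_(size u),
     (nth 0 u i < nth 0 u j) == (nth 0 v i < nth 0 v j)].

(* The subsequences of w are the [mask m w]. *)
Definition contains (w s : seq nat) : bool :=
  [exists m : (size w).-tuple bool, same_order (mask m w) s].

Definition avoids (n : nat) (p : 'S_n) (s : seq nat) : bool :=
  ~~ contains (one_line p) s.

Definition num_desarr (n : nat) (Pi : seq (seq nat)) : nat :=
  #|[set p : 'S_n | desarrangement p && all (avoids p) Pi]|.

Fixpoint jacobsthal (n : nat) : nat :=
  match n with
  | 0 => 0
  | 1 => 1
  | (m.+1 as k).+1 => jacobsthal k + 2 * jacobsthal m
  end.

(* Main.v *)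
Require Import Defs.
From mathcomp Require Import all_boot all_fingroup.
From mathcomp Require Import zify.

(** Let [a_n] and [d_n] count the avoiders of 213 and sigma, and the
    desarrangements among them. A 213-avoider that starts with a descent starts
    with its maximum, and removing that first letter shifts the first ascent by
    one. Since no sigma starts with its largest letter, putting a new maximum in
    front of an avoider gives an avoider, whence [d_(n+1) + d_n = a_n].
    In each case [a_(n+1) = 2 a_n] for [n >= 1]: an avoider of length [n + 1]
    arises from one of length [n] either by putting the maximum in front or by
    one other insertion, which is
    - for 123, the maximum in second position;
    - for 132, the maximum just after the previous maximum;
    - for 231, the minimum in front.
    Together these give the Jacobsthal recurrence
    [d_(n+3) = d_(n+2) + 2 d_(n+1)]. *)

Set Implicit Arguments.
Unset Strict Implicit.
Unset Printing Implicit Defensive.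

(** * Pattern containment as a relation on triples of letters *)

Lemma containsP w s :
  reflect (exists2 u, subseq u w & same_order u s) (contains w s).
Proof.
apply: (iffP existsP) => [[m Hm] | [u /subseqP[m sz_m ->] Hu]].
  by exists (mask m w) => //; apply: mask_subseq.
have sz : size m == size w by rewrite sz_m.
by exists (Tuple sz).
Qed.

(** The diagonal index pairs are trivial; the six remaining comparisons are in a form that linear
    arithmetic can treat. *)
Lemma same_order3 x y z a b c :
  same_order [:: x; y; z] [:: a; b; c] =
  [&& (x < y) == (a < b), (x < z) == (a < c), (y < x) == (b < a),
      (y < z) == (b < c), (z < x) == (c < a) & (z < y) == (c < b)].
Proof.
rewrite /same_order eqxx /=; apply/forallP/idP => [H | H i].
  have E i j (hi : i < 3) (hj : j < 3) := forallP (H (Ordinal hi)) (Ordinal hj).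
  by rewrite (E 0 1) // (E 0 2) // (E 1 0) // (E 1 2) // (E 2 0) // (E 2 1).
case/and5P: H => h1 h2 h3 h4 /andP[h5 h6].
apply/forallP => j; case: i j => [[|[|[|i]]] hi] [[|[|[|j]]] hj] //=;
  by rewrite ?ltnn.
Qed.

(** A pattern of length three becomes an arithmetic relation [R] on its letters, so that occurrences
    are handled without [same_order]. *)
Definition avoids_rel (R : nat -> nat -> nat -> bool) (w : seq nat) : Prop :=
  forall x y z, subseq [:: x; y; z] w -> ~~ R x y z.

Definition first_not_max (R : nat -> nat -> nat -> bool) : Prop :=
  forall x y z, R x y z -> (x < y) || (x < z).

Lemma avoids_relP (a b c : nat) (R : nat -> nat -> nat -> bool) w :
  (forall x y z, same_order [:: x; y; z] [:: a; b; c] = R x y z) ->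
  reflect (avoids_rel R w) (~~ contains w [:: a; b; c]).
Proof.
move=> RE; apply: (iffP idP) => [Hw x y z s | Hw].
  by apply: contra Hw => Hxyz; apply/containsP; exists [:: x; y; z]; rewrite ?RE.
apply/containsP => -[u su]; case: u su => [|x [|y [|z [|t u]]]] su;
  try by rewrite /same_order.
by rewrite RE; apply/negP/Hw.
Qed.

Definition R213 x y z := y < x < z.
Definition R123 x y z := x < y < z.
Definition R132 x y z := x < z < y.
Definition R231 x y z := z < x < y.

Lemma avoid213P w : reflect (avoids_rel R213 w) (~~ contains w [:: 2; 1; 3]).
Proof. by apply: avoids_relP => x y z; rewrite same_order3 /R213 /=; lia. Qed.

Lemma avoid123P w : reflect (avoids_rel R123 w) (~~ contains w [:: 1; 2; 3]).
Proof. by apply: avoids_relP => x y z; rewrite same_order3 /R123 /=; lia. Qed.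

Lemma avoid132P w : reflect (avoids_rel R132 w) (~~ contains w [:: 1; 3; 2]).
Proof. by apply: avoids_relP => x y z; rewrite same_order3 /R132 /=; lia. Qed.

Lemma avoid231P w : reflect (avoids_rel R231 w) (~~ contains w [:: 2; 3; 1]).
Proof. by apply: avoids_relP => x y z; rewrite same_order3 /R231 /=; lia. Qed.

Lemma avoids_rel_subseq R u w :
  subseq u w -> avoids_rel R w -> avoids_rel R u.
Proof. by move=> suw Hw x y z /subseq_trans/(_ suw)/Hw. Qed.

Lemma avoids_rel_cons R a w :
  avoids_rel R w -> (forall y z, subseq [:: y; z] w -> ~~ R a y z) ->
  avoids_rel R (a :: w).
Proof. by move=> Hw Ha x y z /=; case: eqP => [-> /Ha | _ /Hw]. Qed.

Lemma subseq2_mem (T : eqType) (y z : T) w :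
  subseq [:: y; z] w -> (y \in w) * (z \in w).
Proof. by move/mem_subseq => H; rewrite !H ?inE ?eqxx ?orbT. Qed.

(** In an occurrence starting with the new [M], some later letter would have to exceed [M]; all
    other occurrences lie in [u]. *)
Lemma avoids_rel_cons_max (R : nat -> nat -> nat -> bool) M u :
  first_not_max R ->
  {in u, forall x, x <= M} -> avoids_rel R u -> avoids_rel R (M :: u).
Proof.
move=> HR HM Hu; apply: avoids_rel_cons => // y z /subseq2_mem[yu zu].
by apply/negP => /HR; have := HM _ yu; have := HM _ zu; lia.
Qed.

(** * Permutations as words on the letters 1, ..., n *)

Lemma perm_one_line n (p : 'S_n) : perm_eq (one_line p) (iota 1 n).
Proof.
apply: uniq_perm; rewrite ?iota_uniq //.
  rewrite map_inj_uniq ?enum_uniq // => i j [] /val_inj; exact: perm_inj.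
move=> x; apply/mapP/idP => [[i _ ->] | ].
  by rewrite mem_iota add1n !ltnS ltn_ord.
rewrite mem_iota; case: x => // x; rewrite add1n ltnS /= => x_lt.
have hx : x < n by [].
by exists ((p^-1)%g (Ordinal hx)); rewrite ?mem_enum // permKV.
Qed.

Lemma one_line_inj n : injective (@one_line n).
Proof.
move=> p q /eq_in_map E; apply/permP => i; apply: val_inj.
by apply: succn_inj; apply: E; rewrite mem_enum.
Qed.

(** The one-line words are distinct rearrangements of [iota 1 n], and there are n! of both, so the
    two lists agree up to order. *)
Lemma card_one_line n (Q : pred (seq nat)) :
  #|[set p : 'S_n | Q (one_line p)]| = count Q (permutations (iota 1 n)).
Proof.
have U : uniq [seq one_line p | p <- enum {: 'S_n}].
  by rewrite map_inj_uniq ?enum_uniq //; apply: one_line_inj.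
have [] := @uniq_min_size _ _ (permutations (iota 1 n)) U.
- move=> w /mapP[p _ ->]; rewrite mem_permutations; exact: perm_one_line.
- rewrite size_map -cardE card_Sn size_permutations ?iota_uniq //.
  by rewrite size_iota.
move=> _ E.
have /seq.permP <- := uniq_perm U (permutations_uniq _) E.
by rewrite count_map cardsE cardE size_filter -enumT; apply: eq_count => p.
Qed.

Section Words.

Variable n : nat.

Lemma perm_iota_uniq w : perm_eq w (iota 1 n) -> uniq w.
Proof. by move/perm_uniq->; apply: iota_uniq. Qed.

Lemma perm_iota_mem w x : perm_eq w (iota 1 n) -> (x \in w) = (0 < x <= n).
Proof. by move/perm_mem->; rewrite mem_iota add1n ltnS. Qed.

Lemma perm_iota_cat_max p q :
  perm_eq (p ++ n.+1 :: q) (iota 1 n.+1) = perm_eq (p ++ q) (iota 1 n).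
Proof.
have -> : iota 1 n.+1 = rcons (iota 1 n) n.+1.
  by rewrite -cats1 -[in LHS](addn1 n) iotaD add1n.
by rewrite (perm_catCA p [:: n.+1] q) perm_sym perm_rcons perm_cons perm_sym.
Qed.

Lemma perm_iota_cons_max u :
  perm_eq (n.+1 :: u) (iota 1 n.+1) = perm_eq u (iota 1 n).
Proof. exact: (perm_iota_cat_max [::]). Qed.

End Words.

(** * First ascents and the first letter *)

Lemma first_ascent_cons a u :
  {in u, forall x, x < a} -> first_ascent (a :: u) = (first_ascent u).+1.
Proof.
(* For empty [u] the default value 0 fits: [[:: a]] has first ascent 1. *)
case: u => [|b u] // Hu.
have ab : b < a by apply: Hu; rewrite inE eqxx.
rewrite /first_ascent; set v := b :: u.
have a1 : ascent (a :: v) 1 = false by rewrite /ascent /descent /= ab.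
have -> : [seq i <- iota 1 (size (a :: v)) | ascent (a :: v) i] =
          [seq i.+1 | i <- [seq i <- iota 1 (size v) | ascent v i]].
  rewrite -[size (a :: v)]/(1 + size v) iotaD filter_cat.
  rewrite [iota 1 1]/= [filter _ [:: 1]]/= a1 cat0s.
  rewrite (iotaDl 1 1) filter_map; congr map.
  by apply: eq_in_filter => -[|i]; rewrite mem_iota.
(* The last position is always an ascent, so the list is nonempty and [head] commutes with the
   shift. *)
have : size v \in [seq i <- iota 1 (size v) | ascent v i].
  by rewrite mem_filter mem_iota /ascent /descent /=; lia.
by case: [seq i <- _ | _].
Qed.

Lemma first_ascent1 a b u : a < b -> first_ascent [:: a, b & u] = 1.
Proof.
by move=> ab; rewrite /first_ascent /= /ascent /descent /= ltnNge (ltnW ab).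
Qed.

(** * Avoiders as duplicate-free lists of words *)

Definition avoiders s n :=
  [seq w <- permutations (iota 1 n)
     | ~~ contains w [:: 2; 1; 3] && ~~ contains w s].

Definition even_first_ascent w := ~~ odd (first_ascent w).

Lemma mem_avoiders s n w :
  (w \in avoiders s n) = [&& ~~ contains w [:: 2; 1; 3], ~~ contains w s
                          & perm_eq w (iota 1 n)].
Proof. by rewrite mem_filter mem_permutations andbA. Qed.

Lemma avoiders_uniq s n : uniq (avoiders s n).
Proof. exact/filter_uniq/permutations_uniq. Qed.

Lemma num_desarrE s n :
  num_desarr n [:: [:: 2; 1; 3]; s] = count even_first_ascent (avoiders s n).
Proof.
rewrite /num_desarr -size_filter /avoiders -filter_predI size_filter.
rewrite -card_one_line; apply: eq_card => p.
by rewrite !inE /desarrangement /avoids /= andbT.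
Qed.

Lemma avoiders_cons_max s (R : nat -> nat -> nat -> bool) :
  (forall w, reflect (avoids_rel R w) (~~ contains w s)) ->
  first_not_max R ->
  forall n u, (n.+1 :: u \in avoiders s n.+1) = (u \in avoiders s n).
Proof.
move=> RP Rmax n u; rewrite !mem_avoiders perm_iota_cons_max.
apply/and3P/and3P => -[/avoid213P H1 /RP H2 pu]; split=> //.
- by apply/avoid213P; apply: avoids_rel_subseq H1; apply: subseq_cons.
- by apply/RP; apply: avoids_rel_subseq H2; apply: subseq_cons.
- apply/avoid213P/avoids_rel_cons_max => // [x y z|x].
    by rewrite /R213; lia.
  by rewrite (perm_iota_mem _ pu); lia.
- apply/RP/avoids_rel_cons_max => // x.
  by rewrite (perm_iota_mem _ pu); lia.
Qed.

(* A descent at the front followed by a later maximum would be a 213. *)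
Lemma even_first_ascent_avoider s n w : w \in avoiders s n.+1 ->
  even_first_ascent w =
  (head 0 w == n.+1) && ~~ even_first_ascent (behead w).
Proof.
rewrite mem_avoiders => /and3P[/avoid213P H1 _ pw].
have U := perm_iota_uniq pw.
have mem x := perm_iota_mem x pw.
have : n.+1 \in w by rewrite mem; lia.
case: w H1 pw U mem => //= a u H1 pw /andP[au U] mem.
case: eqP => [a_n _ | /eqP na].
  rewrite /even_first_ascent first_ascent_cons //= => x xu.
  have := mem x; rewrite inE xu orbT => /esym.
  have: x != n.+1 by rewrite -a_n; apply: contra au => /eqP <-.
  by rewrite a_n; lia.
rewrite inE eq_sym (negbTE na) /=.
case: u H1 pw au U mem => //= b u H1 pw abu /andP[bu U] mem.
rewrite inE => nu; have ab : a < b.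
  move: abu; rewrite inE negb_or => /andP[nab _].
  case: ltngtP nab => // ba _.
  have := mem a; rewrite inE eqxx /= => /esym a_le.
  case/predU1P: nu => [nb | nu]; first by lia.
  have := H1 a b n.+1; rewrite /= !eqxx sub1seq => /(_ nu).
  by rewrite /R213; lia.
by rewrite /even_first_ascent first_ascent1.
Qed.

(** * Recurrences shared by the three patterns *)

Section Recurrences.

Variables (s : seq nat) (R : nat -> nat -> nat -> bool).
Hypothesis RP : forall w, reflect (avoids_rel R w) (~~ contains w s).
Hypothesis Rmax : first_not_max R.

(** Prefixing [n.+1] raises the first ascent by one, hence maps the avoiders of length [n] with odd
    first ascent bijectively onto the desarrangements among those of length [n.+1]. *)
Lemma count_even_first_ascent n :
  count even_first_ascent (avoiders s n.+1)
    + count even_first_ascent (avoiders s n) = size (avoiders s n).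
Proof.
rewrite -[RHS](count_predC even_first_ascent) addnC; congr (_ + _).
rewrite -!size_filter -[RHS](size_map (cons n.+1)).
apply/perm_size/uniq_perm.
- exact/filter_uniq/avoiders_uniq.
- rewrite map_inj_uniq => [|u v []] //; exact/filter_uniq/avoiders_uniq.
move=> w; rewrite mem_filter; apply/andP/mapP => [[ew Hw] | [u]].
  move: ew; rewrite (even_first_ascent_avoider Hw) => /andP[].
  case: w Hw => //= a u Hw /eqP a_n eu; exists u; last by rewrite a_n.
  by rewrite a_n in Hw; rewrite mem_filter /= eu -(avoiders_cons_max RP Rmax).
rewrite mem_filter => /andP[/= eu]; rewrite -(avoiders_cons_max RP Rmax).
by move=> Hu ->; rewrite (even_first_ascent_avoider Hu) /= eqxx eu.
Qed.

(** The map [g n] is the second insertion: the hypotheses make it a bijection onto the avoiders that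
    do not start with their maximum. Those that do arise by prefixing. *)
Lemma size_avoiders_double (g : nat -> seq nat -> seq nat) :
  (forall n u, u \in avoiders s n.+1 ->
     (g n u \in avoiders s n.+2) && (head 0 (g n u) != n.+2)) ->
  (forall n w, w \in avoiders s n.+2 -> head 0 w != n.+2 ->
     exists2 u, u \in avoiders s n.+1 & w = g n u) ->
  (forall n, {in avoiders s n.+1 &, injective (g n)}) ->
  forall n, size (avoiders s n.+2) = 2 * size (avoiders s n.+1).
Proof.
move=> gA gE injg n.
transitivity (size (map (cons n.+2) (avoiders s n.+1)
                    ++ map (g n) (avoiders s n.+1))); last first.
  by rewrite size_cat !size_map addnn mul2n.
apply/perm_size/uniq_perm; first exact: avoiders_uniq.
  have injc : {in avoiders s n.+1 &, injective (cons n.+2)}.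
    by move=> u v _ _ [].
  rewrite cat_uniq (map_inj_in_uniq injc) (map_inj_in_uniq (injg n)).
  rewrite avoiders_uniq andbT; apply/hasPn => _ /mapP[v /gA/andP[_ Hv] ->].
  by apply/mapP => -[u Hu E]; rewrite E /= eqxx in Hv.
move=> w; rewrite mem_cat; apply/idP/orP => [Hw | [] /mapP[u Hu ->]].
- have [hw | hw] := eqVneq (head 0 w) n.+2; last first.
    by right; have [u Hu ->] := gE _ _ Hw hw; apply: map_f.
  case: w hw Hw => //= a u ->; rewrite (avoiders_cons_max RP Rmax) => Hu.
  by left; apply: map_f.
- by rewrite (avoiders_cons_max RP Rmax).
- by have /andP[] := gA _ _ Hu.
Qed.

Lemma count_avoiders_jacobsthal :
  (forall n, size (avoiders s n.+2) = 2 * size (avoiders s n.+1)) ->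
  forall n, count even_first_ascent (avoiders s n.+1) = jacobsthal n.
Proof.
move=> dbl.
(* A word of length one has no subsequence of three letters. *)
have A1 : avoiders s 1 = [:: [:: 1]].
  rewrite /avoiders /=; case: avoid213P => [_|[]]; last first.
    by move=> x y z /size_subseq.
  by case: RP => [|[]] // x y z /size_subseq.
have d1 : count even_first_ascent (avoiders s 1) = 0 by rewrite A1.
have d2 : count even_first_ascent (avoiders s 2) = 1.
  by have := count_even_first_ascent 1; rewrite d1 A1 /=; lia.
(* The recurrence reaches back two steps, so the induction carries two consecutive values. *)
suff H n : count even_first_ascent (avoiders s n.+1) = jacobsthal n /\
           count even_first_ascent (avoiders s n.+2) = jacobsthal n.+1.
  by move=> n; case: (H n).
elim: n => [|n [IH1 IH2]]; first by [].
split=> //; rewrite [jacobsthal _]/= -/(jacobsthal n.+1) -IH1 -IH2.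
(* d_(n+3) + d_(n+2) = a_(n+2) = 2 a_(n+1) = 2 (d_(n+2) + d_(n+1)). *)
have := count_even_first_ascent n.+2; have := count_even_first_ascent n.+1.
by rewrite dbl; lia.
Qed.

End Recurrences.

Lemma patterns_first_not_max :
  [/\ first_not_max R123, first_not_max R132 & first_not_max R231].
Proof. by split=> x y z; rewrite /R123 /R132 /R231; lia. Qed.

(** * The pattern 123: the maximum in second position *)

Definition insert2 (M : nat) (u : seq nat) :=
  if u is a :: t then [:: a, M & t] else [::].

(* With two letters before the maximum, they form either a 12 or a 21. *)
Lemma size_avoiders123 n :
  size (avoiders [:: 1; 2; 3] n.+2) = 2 * size (avoiders [:: 1; 2; 3] n.+1).
Proof.
have [Rmax _ _] := patterns_first_not_max.
apply: (size_avoiders_double avoid123P Rmax (g := fun n => insert2 n.+2)) n.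
- move=> n [|a u]; rewrite !mem_avoiders;
    case/and3P => /avoid213P H1 /avoid123P H2 pu.
    by have := perm_size pu.
  have mem x := perm_iota_mem x pu.
  have a_le : a <= n.+1 by have := mem a; rewrite inE eqxx; lia.
  have u_le x : x \in u -> x <= n.+1.
    by move=> xu; have := mem x; rewrite inE xu orbT; lia.
  (* This serves 213 and 123 alike. Occurrences starting with the maximum are excluded by
     [first_not_max], those starting with [a] and the maximum by the second premise; all others lie
     in [a :: u]. *)
  have Hu (R' : nat -> nat -> nat -> bool) : first_not_max R' ->
      (forall z, z <= n.+1 -> ~~ R' a n.+2 z) ->
      avoids_rel R' (a :: u) -> avoids_rel R' [:: a, n.+2 & u].
    move=> Rm Ra H; apply: avoids_rel_cons.
      apply: avoids_rel_cons_max => // [x /u_le|]; first by lia.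
      by apply: avoids_rel_subseq H; apply: subseq_cons.
    move=> y z /=; case: eqP => [-> | _ syz].
      by rewrite sub1seq => /u_le /Ra.
    by apply: H; rewrite /= eqxx.
  apply/andP; split; last by rewrite /=; lia.
  apply/and3P; split.
  + by apply/avoid213P/Hu => // [x y z|z]; rewrite /R213; lia.
  + by apply/avoid123P/Hu => // z; rewrite /R123; lia.
  + by rewrite /= (perm_iota_cat_max _ [:: a]).
- move=> n w; rewrite mem_avoiders => /and3P[/avoid213P H1 /avoid123P H2 pw] hw.
  have mem x := perm_iota_mem x pw.
  have U := perm_iota_uniq pw.
  have Mw : n.+2 \in w by rewrite mem; lia.
  case: w Mw H1 H2 pw hw U mem => //= a [|b u] Mw H1 H2 pw hw U mem.
    by move: Mw; rewrite inE eq_sym (negbTE hw).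
  have bM : b = n.+2.
    apply/eqP; apply: contraT => hb.
    have Mu : n.+2 \in u.
      by move: Mw; rewrite !inE eq_sym (negbTE hw) eq_sym (negbTE hb).
    have sM : subseq [:: a; b; n.+2] [:: a, b & u] by rewrite /= !eqxx sub1seq.
    have := H1 _ _ _ sM; have := H2 _ _ _ sM; rewrite /R123 /R213.
    have := mem a; have := mem b; rewrite !inE !eqxx orbT.
    have ab : a != b by move: U; rewrite /= inE; case: eqP.
    by lia.
  have sub : subseq (a :: u) [:: a, b & u].
    by rewrite /= eqxx; apply: subseq_cons.
  exists (a :: u); last by rewrite bM.
  rewrite mem_avoiders; apply/and3P; split.
  + by apply/avoid213P; apply: avoids_rel_subseq H1.
  + by apply/avoid123P; apply: avoids_rel_subseq H2.
  + by rewrite bM in pw; rewrite -(perm_iota_cat_max _ [:: a]).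
- by move=> n [|a u] [|b v]; rewrite !mem_avoiders //= => _ _ [-> ->].
Qed.

(** * The pattern 231: a new minimum in front *)

Lemma avoids_rel_mapS (R : nat -> nat -> nat -> bool) u :
  (forall x y z, R x.+1 y.+1 z.+1 = R x y z) ->
  avoids_rel R [seq x.+1 | x <- u] <-> avoids_rel R u.
Proof.
move=> RS; split=> [H x y z /(map_subseq succn)/H | H x y z].
  by rewrite RS.
(* An occurrence in the shifted word is the shift of the triple that the same mask selects in
   [u]. *)
case/subseqP => m _; rewrite -map_mask.
case E: (mask m u) => [|a [|b [|c [|d v]]]] //= [-> -> ->].
by rewrite RS; apply: H; rewrite -E mask_subseq.
Qed.

Lemma subseq2_total (T : eqType) (x y : T) w : x \in w -> y \in w -> x != y ->
  subseq [:: x; y] w || subseq [:: y; x] w.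
Proof.
elim: w => // a w IH; rewrite !inE /=.
have [-> | xa] := eqVneq x a; have [-> | ya] := eqVneq y a => //=.
- by rewrite sub1seq => _ ->.
- by rewrite !sub1seq => -> _; rewrite orbT.
Qed.

(** The old letters move up by one to free the value 1. *)
Definition cons_min (u : seq nat) := 1 :: [seq x.+1 | x <- u].

Lemma perm_iota_cons_min n u :
  perm_eq (cons_min u) (iota 1 n.+1) = perm_eq u (iota 1 n).
Proof.
have -> : iota 1 n.+1 = cons_min (iota 1 n) by rewrite /cons_min -(iotaDl 1).
rewrite perm_cons; apply/idP/idP => [|]; last exact: perm_map.
by apply: perm_map_inj => x y [].
Qed.

(* The first letter is extremal: otherwise the minimum and the maximum both
   come later, and complete it to a 213 or a 231. *)
Lemma size_avoiders231 n :
  size (avoiders [:: 2; 3; 1] n.+2) = 2 * size (avoiders [:: 2; 3; 1] n.+1).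
Proof.
have [_ _ Rmax] := patterns_first_not_max.
apply: (size_avoiders_double avoid231P Rmax (g := fun n => cons_min)) n.
- move=> n u; rewrite !mem_avoiders => /and3P[/avoid213P H1 /avoid231P H2 pu].
  (* The leading 1 is below all other letters, whereas 213 and 231 both start with their middle
     value. *)
  have pos x : x \in [seq x.+1 | x <- u] -> 1 < x.
    case/mapP => y; rewrite (perm_iota_mem _ pu) => yu ->; lia.
  apply/andP; split=> //; apply/and3P; split.
  + apply/avoid213P/avoids_rel_cons; first exact/avoids_rel_mapS.
    by move=> y z /subseq2_mem[/pos yu /pos zu]; rewrite /R213; lia.
  + apply/avoid231P/avoids_rel_cons; first exact/avoids_rel_mapS.
    by move=> y z /subseq2_mem[/pos yu /pos zu]; rewrite /R231; lia.
  + by rewrite perm_iota_cons_min.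
- move=> n w; rewrite mem_avoiders => /and3P[/avoid213P H1 /avoid231P H2 pw] hw.
  have mem x := perm_iota_mem x pw.
  have U := perm_iota_uniq pw.
  have Mw : n.+2 \in w by rewrite mem; lia.
  have mw : 1 \in w by rewrite mem; lia.
  case: w Mw mw H1 H2 pw hw U mem => //= a t Mw mw H1 H2 pw hw /andP[a_t U] mem.
  have Mt : n.+2 \in t by move: Mw; rewrite inE eq_sym (negbTE hw).
  have a1 : a = 1.
    apply/eqP; apply: contraT => ha.
    have mt : 1 \in t by move: mw; rewrite inE eq_sym (negbTE ha).
    have := mem a; rewrite inE eqxx /= => /esym a_le.
    have /orP[st|st] : subseq [:: 1; n.+2] t || subseq [:: n.+2; 1] t.
      exact: subseq2_total.
    + by have := H1 a 1 n.+2; rewrite /R213 [subseq _ _]/= eqxx => /(_ st); lia.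
    + by have := H2 a n.+2 1; rewrite /R231 [subseq _ _]/= eqxx => /(_ st); lia.
  (* The letters of [t] are positive, so the shift undoes [.-1]. *)
  have tE : t = [seq x.+1 | x <- [seq x.-1 | x <- t]].
    rewrite -map_comp -[LHS]map_id; apply/eq_in_map => x xt /=.
    by have := mem x; rewrite inE xt orbT; lia.
  move: H1 H2 pw; rewrite a1 tE; set u := [seq x.-1 | x <- t] => H1 H2 pw.
  have sub : subseq [seq x.+1 | x <- u] (1 :: [seq x.+1 | x <- u]).
    exact: subseq_cons.
  exists u => //; rewrite mem_avoiders; apply/and3P; split.
  + apply/avoid213P; apply/(avoids_rel_mapS (R := R213)) => //.
    by apply: avoids_rel_subseq H1.
  + apply/avoid231P; apply/(avoids_rel_mapS (R := R231)) => //.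
    by apply: avoids_rel_subseq H2.
  + by rewrite -perm_iota_cons_min.
- by move=> n u v _ _ [] /inj_map; apply=> x y [].
Qed.

(** * The pattern 132: the maximum just after the previous maximum *)

(** Uniqueness forces the final [M] of the subsequence onto the displayed [M], so everything before
    it comes from [p]. *)
Lemma subseq_rcons_cat (T : eqType) (M : T) s p q :
  uniq (p ++ M :: q) -> subseq (rcons s M) (p ++ M :: q) -> subseq s p.
Proof.
elim: p s => [|a p IH] [|x s] //=.
- move=> /andP[Mq _] Hs; case/negP: Mq.
  have : subseq (rcons s M) q by case: eqP Hs => // _ /cons_subseq.
  by move/mem_subseq; apply; rewrite mem_rcons inE eqxx.
- by case/andP => _ /IH H; case: eqP => _; [exact: H | exact: (H (x :: s))].
Qed.

Lemma subseq_cons_cat (T : eqType) (M : T) s p q :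
  uniq (p ++ M :: q) -> subseq (M :: s) (p ++ M :: q) -> subseq s q.
Proof.
elim: p => [|a p IH] /=; first by rewrite eqxx.
case/andP => a_p /IH H; case: eqP => // Ma.
by rewrite -Ma mem_cat inE eqxx orbT in a_p.
Qed.

Definition insert_after (m M : nat) (u : seq nat) :=
  take (index m u).+1 u ++ M :: drop (index m u).+1 u.

Lemma insert_after_cat m M p q :
  m \notin p -> insert_after m M (p ++ m :: q) = p ++ [:: m, M & q].
Proof.
move=> mp; rewrite /insert_after index_cat (negbTE mp) /= eqxx addn0.
rewrite -(cat_rcons _ _ q) take_size_cat ?drop_size_cat ?size_rcons //.
by rewrite cat_rcons.
Qed.

(** Deleting [M] undoes the insertion; this is how injectivity is obtained. *)
Lemma filter_insert_after m M u :
  M \notin u -> [seq x <- insert_after m M u | x != M] = u.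
Proof.
move=> Mu; rewrite filter_cat /= eqxx /= -filter_cat cat_take_drop.
by apply/all_filterP/allP => x xu; apply: contraNneq Mu => <-.
Qed.

(** Occurrences without the new maximum [m.+1] survive its deletion, so they lie in the old word.
    Those using it must be traded for an old occurrence, which is the premise left to each
    pattern. *)
Lemma avoids_insert_after (R : nat -> nat -> nat -> bool) m p q :
  (forall x y z, [&& x <= m.+1, y <= m.+1 & z <= m.+1] ->
     m.+1 \in [:: x; y; z] -> R x y z ->
     subseq [:: x; y; z] (p ++ [:: m, m.+1 & q]) ->
     exists x' y' z', subseq [:: x'; y'; z'] (p ++ m :: q) && R x' y' z') ->
  {in p ++ m :: q, forall x, x <= m} ->
  avoids_rel R (p ++ m :: q) -> avoids_rel R (p ++ [:: m, m.+1 & q]).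
Proof.
move=> HM le_m H x y z sxyz; apply/negP => Rxyz.
have le_M t : t \in [:: x; y; z] -> t <= m.+1.
  move/(mem_subseq sxyz); rewrite mem_cat !inE => Ht.
  have [-> // | tM] := eqVneq t m.+1.
  apply/leqW/le_m; move: Ht; rewrite (negbTE tM) /=.
  by rewrite mem_cat inE.
have [Mxyz | Mxyz] := boolP (m.+1 \in [:: x; y; z]).
  have [|x' [y' [z' /andP[s' R']]]] := HM x y z _ Mxyz Rxyz sxyz.
    by rewrite !le_M ?inE ?eqxx ?orbT.
  by have := H _ _ _ s'; rewrite R'.
have : subseq [:: x; y; z] [seq t <- p ++ [:: m, m.+1 & q] | t != m.+1].
  rewrite subseq_filter sxyz andbT.
  by apply/allP => t Ht; apply: contraNneq Mxyz => <-.
have -> : [seq t <- p ++ [:: m, m.+1 & q] | t != m.+1] = p ++ m :: q.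
  rewrite filter_cat /= eqxx /= (_ : m != m.+1) ?neq_ltn ?leqnn //.
  have F r : {subset r <= p ++ m :: q} -> [seq t <- r | t != m.+1] = r.
    move=> sr; apply/all_filterP/allP => t /sr/le_m; lia.
  rewrite !F // => t; rewrite mem_cat ?inE => ->; by rewrite ?orbT.
by move/H; rewrite Rxyz.
Qed.

(* The letters before the maximum increase, and exceed all letters after it,
   so the maximum is preceded by the second largest letter. *)
Lemma size_avoiders132 n :
  size (avoiders [:: 1; 3; 2] n.+2) = 2 * size (avoiders [:: 1; 3; 2] n.+1).
Proof.
have [_ Rmax _] := patterns_first_not_max.
apply: (size_avoiders_double avoid132P Rmax
          (g := fun n => insert_after n.+1 n.+2)) n.
- move=> n u; rewrite !mem_avoiders => /and3P[/avoid213P H1 /avoid132P H2 pu].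
  have mem x := perm_iota_mem x pu.
  have U := perm_iota_uniq pu.
  have mu : n.+1 \in u by rewrite mem; lia.
  move: H1 H2 pu mem U; case/splitPr: mu => p q H1 H2 pu mem U.
  have mp : n.+1 \notin p.
    by move: U; rewrite uniq_catC /= mem_cat negb_or; case/andP => /andP[].
  have mq : n.+1 \notin q.
    by move: U; rewrite uniq_catC /= mem_cat negb_or; case/andP => /andP[].
  rewrite insert_after_cat //.
  have pM : perm_eq (p ++ [:: n.+1, n.+2 & q]) (iota 1 n.+2).
    by rewrite -cat_rcons perm_iota_cat_max cat_rcons.
  have UM := perm_iota_uniq pM.
  have le_m : {in p ++ n.+1 :: q, forall x, x <= n.+1}.
    by move=> x; rewrite mem; lia.
  rewrite pM andbT; apply/andP; split; last first.
    case: p mp {H1 H2 pu U pM UM mem} le_m => [|a p] mp le_m /=; first by lia.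
    by have := le_m a; rewrite inE eqxx => /(_ isT); lia.
  rewrite -cat_rcons in UM.
  apply/andP; split.
  + apply/avoid213P/avoids_insert_after => // x y z le3 Mxyz.
    rewrite /R213 => Rxyz; rewrite -cat_rcons.
    (* In a 213 the new maximum can only be the last letter; [n.+1] replaces it once [x] and [y] are
       known to lie in [p]. *)
    have -> : z = n.+2 by move: Mxyz; rewrite !inE; lia.
    move/(subseq_rcons_cat (s := [:: x; y]) UM) => sxy.
    (* Nothing follows [n.+1] in [rcons p n.+1], so [y] could not come after it. *)
    have xm : x != n.+1.
      apply/negP => /eqP xm; move: UM; rewrite cat_uniq => /andP[+ _].
      rewrite -cats1 => /(subseq_cons_cat (s := [:: y])).
      by rewrite xm in sxy; rewrite cats1 => /(_ sxy).
    have {}sxy : subseq [:: x; y] p.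
      apply: subseq_trans (filter_subseq (predC1 n.+1) p).
      have <- : filter (predC1 n.+1) (rcons p n.+1) = filter (predC1 n.+1) p.
        by rewrite filter_rcons /= eqxx.
      by rewrite subseq_filter sxy /= xm /=; lia.
    exists x, y, n.+1; apply/andP; split.
      rewrite -[[:: x; y; _]]/([:: x; y] ++ [:: n.+1]); apply: cat_subseq => //.
      by rewrite sub1seq inE eqxx.
    by lia.
  + apply/avoid132P/avoids_insert_after => // x y z le3 Mxyz.
    rewrite /R132 => Rxyz; rewrite -cat_rcons.
    (* In a 132 the new maximum can only be the middle letter; again [n.+1] replaces it. *)
    have -> : y = n.+2 by move: Mxyz; rewrite !inE; lia.
    move=> sub.
    have zq : z \in q.
      rewrite -sub1seq; apply: (subseq_cons_cat UM).
      by apply: subseq_trans sub; apply: subseq_cons.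
    have xp : x \in rcons p n.+1.
      rewrite -sub1seq; apply: (subseq_rcons_cat (s := [:: x]) UM).
      apply: subseq_trans sub; apply: (prefix_subseq [:: x; n.+2] [:: z]).
    have zm : z != n.+1 by apply: contraNneq mq => <-.
    exists x, n.+1, z; apply/andP; split; last by lia.
    apply: (@cat_subseq _ [:: x] _ p); last by rewrite /= eqxx sub1seq.
    (* If [x] were [n.+1], no value would be left for [z] below the maximum. *)
    by move: xp; rewrite sub1seq mem_rcons inE => /predU1P[xm|//]; lia.
- move=> n w; rewrite mem_avoiders => /and3P[/avoid213P H1 /avoid132P H2 pw] hw.
  have mem x := perm_iota_mem x pw.
  have U := perm_iota_uniq pw.
  have Mw : n.+2 \in w by rewrite mem; lia.
  move: H1 H2 pw hw mem U; case/splitPr: Mw => p q.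
  (* By [hw] the maximum is not in front, so it has a predecessor [b]. *)
  case/lastP: p => [|p b]; first by rewrite /= eqxx.
  rewrite cat_rcons => H1 H2 pw hw mem U.
  have bm : b = n.+1.
    apply/eqP; apply: contraT => hb.
    have b_lt : b < n.+1.
      have bM : b != n.+2.
        move: U; rewrite cat_uniq => /and3P[_ _ /=].
        by rewrite inE negb_or => /andP[/andP[]].
      by have := mem b; rewrite mem_cat inE eqxx orbT; lia.
    have : n.+1 \in p ++ [:: b, n.+2 & q] by rewrite mem; lia.
    rewrite mem_cat !inE (eq_sym _ b) (negbTE hb).
    rewrite (_ : (n.+1 == n.+2) = false) /=; last by lia.
    (* Before [b], the letter [n.+1] starts a 213 with [b] and the maximum; after the maximum it
       completes both to a 132. *)
    case/orP => [mp | mq].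
      have := H1 n.+1 b n.+2; rewrite /R213 b_lt ltnSn; case/(_ _)/negP => //.
      apply: (@cat_subseq _ [:: n.+1] _ p); first by rewrite sub1seq.
      by rewrite /= !eqxx sub0seq.
    have := H2 b n.+2 n.+1; rewrite /R132 b_lt ltnSn; case/(_ _)/negP => //.
    apply: (@cat_subseq _ [::] _ p); first exact: sub0seq.
    by rewrite /= !eqxx sub1seq.
  rewrite bm in H1 H2 pw mem U.
  have sub : subseq (p ++ n.+1 :: q) (p ++ [:: n.+1, n.+2 & q]).
    by rewrite subseq_cat2l /= eqxx; apply: subseq_cons.
  exists (p ++ n.+1 :: q).
    rewrite mem_avoiders; apply/and3P; split.
    + by apply/avoid213P; apply: avoids_rel_subseq H1.
    + by apply/avoid132P; apply: avoids_rel_subseq H2.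
    + by rewrite -cat_rcons -perm_iota_cat_max cat_rcons.
  rewrite insert_after_cat ?bm //.
  by move: U; rewrite uniq_catC /= inE mem_cat !negb_or; case/andP => /and3P[].
- move=> n u v; rewrite !mem_avoiders.
  move=> /and3P[_ _ pu] /and3P[_ _ pv] E.
  rewrite -(@filter_insert_after n.+1 n.+2 u).
    rewrite E filter_insert_after // (perm_iota_mem _ pv); lia.
  by rewrite (perm_iota_mem _ pu); lia.
Qed.

(** * Jacobsthal numbers for the three patterns *)

Theorem theorem3p17 (n : nat) (sigma : seq nat) (hn : 1 <= n)
  (hsigma : sigma \in [:: [:: 1; 2; 3]; [:: 1; 3; 2]; [:: 2; 3; 1]]) :
  num_desarr n [:: [:: 2; 1; 3]; sigma] = jacobsthal n.-1.
Proof.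
case: n hn => // n _; rewrite num_desarrE.
have [Rmax123 Rmax132 Rmax231] := patterns_first_not_max.
move: hsigma; rewrite !inE => /or3P[] /eqP ->.
- exact: (count_avoiders_jacobsthal avoid123P Rmax123 size_avoiders123).
- exact: (count_avoiders_jacobsthal avoid132P Rmax132 size_avoiders132).
- exact: (count_avoiders_jacobsthal avoid231P Rmax231 size_avoiders231).
Qed.
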